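(* Let $\mathbb{L}$ be a linearly ordered set. Then, for every $u_1<\cdots<u_m$ in $\mathbb{L}$ and all $a_1,\ldots,a_m\in\mathbb{R}$, $$\Big\|\sum_{i=1}^m a_i s_i\Big\|_\infty\le\Big\|\sum_{i=1}^m a_i\delta_{u_i}\Big\|_\ast\le 6\Big\|\sum_{i=1}^m a_i s_i\Big\|_\infty,$$ where $s_i=(\underbrace{1,1,\ldots,1}_{i},0,0,0,\ldots)\in c_0$ and $\|\cdot\|_\infty$ is the supremum norm of $c_0$.
   Context: Let $\mathbb{L}^\ast$ be the set of all lattice homomorphisms $x^\ast:\mathbb{L}\to[-1,1]$, which for linearly ordered $\mathbb{L}$ (with $\wedge=\min$, $\vee=\max$) are exactly the nondecreasing functions. For $x\in\mathbb{L}$, $\delta_x:\mathbb{L}^\ast\to\mathbb{R}$ is $\delta_x(x^\ast)=x^\ast(x)$. For $f:\mathbb{L}^\ast\to\mathbb{R}$, $$\|f\|_\ast=\sup\Big\{\sum_{i=1}^n|f(x_i^\ast)| : n\in\mathbb{N},\ x_1^\ast,\ldots,x_n^\ast\in\mathbb{L}^\ast,\ \sup_{x\in\mathbb{L}}\sum_{i=1}^n|x_i^\ast(x)|\le 1\Big\}.$$ This is the norm of the free Banach lattice $FBL\langle\mathbb{L}\rangle$ generated by $\mathbb{L}$, realized as the smallest norm-closed vector sublattice containing $\{\delta_x:x\in\mathbb{L}\}$ inside the Banach lattice of all $f:\mathbb{L}^\ast\to\mathbb{R}$ with $\|f\|_\ast<\infty$ (pointwise operations). *)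

(* Defs.v *)
From HB Require Import structures.
From mathcomp Require Import all_boot all_order all_algebra.
From mathcomp Require Import all_classical all_reals all_analysis.

Set Implicit Arguments.
Unset Strict Implicit.
Unset Printing Implicit Defensive.

Import Order.TTheory GRing.Theory Num.Theory.
Import numFieldNormedType.Exports.

Local Open Scope classical_set_scope.
Local Open Scope ring_scope.

Section FreeBanachLattice.
Context (d : Order.disp_t) (L : latticeType d) (R : realType).

(* The order morphism field packed in [{lmorphism L -> R}] is implied by
   compatibility with meets, so these are all the lattice homomorphisms. *)
Record lattice_dual := LatticeDual {
  dual_hom :> {lmorphism L -> R} ;
  dual_hom_itv : forall x : L, dual_hom x \in `[-1, 1] }.

Definition delta (x : L) : lattice_dual -> R := fun xs => xs x.

(* The admissible families of the supremum defining the norm; the inner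
   supremum is taken in [\bar R], where the supremum of set0 is -oo. *)
Definition admissible (n : nat) (xs : 'I_n -> lattice_dual) : Prop :=
  (ereal_sup (range (fun x : L => (\sum_(i < n) `|xs i x|)%:E)) <= 1%:E)%E.

(* Extended-real valued, so that it makes sense for every f; the underlying
   set of the Banach lattice containing the free one is [fbl_norm f < +oo]. *)
Definition fbl_norm (f : lattice_dual -> R) : \bar R :=
  ereal_sup [set r | exists n (xs : 'I_n -> lattice_dual),
    admissible xs /\ r = (\sum_(i < n) `|f (xs i)|)%:E].

End FreeBanachLattice.

Section C0.
Context (R : realType).

Definition c0 : {pred nat -> R} :=
  mem [set x : nat -> R | x n @[n --> \oo] --> (0 : R)].

Fact c0_submod_closed : submod_closed c0.
Proof.
split=> [|a x y]; rewrite !inE /=; first exact: cvg_cst.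
move=> x0 y0; have -> : (0 : R) = a * 0 + 0 by rewrite mulr0 addr0.
by apply: cvgD => //; apply: cvgM => //; apply: cvg_cst.
Qed.

HB.instance Definition _ := GRing.isSubmodClosed.Build R (nat -> R) c0
  c0_submod_closed.

Record c0_space := C0 { c0_val :> nat -> R ; c0P : c0_val \in c0 }.

HB.instance Definition _ := [isSub for c0_val].
HB.instance Definition _ := [Choice of c0_space by <:].
HB.instance Definition _ := [SubChoice_isSubLmodule of c0_space by <:].

Definition c0_norm (x : c0_space) : \bar R :=
  ereal_sup (range (fun k : nat => `|x k|%:E)).

(* Coordinates are indexed from 0: exactly the first n of them are 1. *)
Definition summing_seq (n : nat) : nat -> R := fun k => (k < n)%N%:R.

Fact summing_seq_c0 n : summing_seq n \in c0.
Proof.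
rewrite inE /=; apply: cvg_near_cst.
by exists n => // k /= nk; rewrite /summing_seq ltnNge nk.
Qed.

Definition summing (n : nat) : c0_space := C0 (summing_seq_c0 n).

End C0.

(* Main.v *)
From HB Require Import structures.
Require Import Defs.
From mathcomp Require Import all_boot all_order all_algebra.
From mathcomp Require Import all_classical all_reals all_analysis.
From mathcomp Require Import lra.
Import Order.TTheory GRing.Theory Num.Theory.
Import numFieldNormedType.Exports.
Local Open Scope ring_scope.
Local Open Scope ereal_scope.

(** The k-th coordinate of [sum_i a_i s_i] is the tail sum
    [T_k = sum_(i >= k) a_i].  Evaluating [sum_i a_i delta_(u_i)] at the
    indicator function of [[u_k, +oo)] gives exactly [T_k], hence the lower
    bound.  For the upper bound, Abel summation writes the value at [x*] as
    [T_0 x*(u_0) + sum_(k >= 1) T_k (x*(u_k) - x*(u_(k-1)))]; as [x*] is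
    nondecreasing the increments telescope, so this is at most
    [M (2 |x*(u_0)| + |x*(u_(m-1))|)] with [M = max_k |T_k|].  Summing over an
    admissible family even gives the constant 3 instead of 6. *)

(** Induction removing the first index: the sum changes by the tail of [a] from 1 on, times the
    nonnegative increment [z ord0 - y ord0]. *)
Lemma abel_tail_bound (R : realDomainType) (M : R) (n : nat)
    (a y : 'I_n.+1 -> R) :
  (forall i j : 'I_n.+1, (i <= j)%N -> (y i <= y j)%R) ->
  (forall k : nat, (`|\sum_(i < n.+1 | (k <= i)%N) a i| <= M)%R) ->
  (`|\sum_(i < n.+1) a i * y i - (\sum_(i < n.+1) a i) * y ord0|
    <= M * (y ord_max - y ord0))%R.
Proof.
elim: n a y => [|n IHn] a y y_le a_le.
  by rewrite !big_ord1 !subrr normr0 (_ : ord_max = ord0) ?subrr ?mulr0//;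
    exact/val_inj.
set b := fun i : 'I_n.+1 => a (lift ord0 i).
set z := fun i : 'I_n.+1 => y (lift ord0 i).
(* The tail of [b] from [k] is the tail of [a] from [k.+1], where index 0 drops out. *)
have b_le k : (`|\sum_(i < n.+1 | (k <= i)%N) b i| <= M)%R.
  apply: le_trans (a_le k.+1); rewrite [in leRHS]big_mkcond big_ord_recl /=.
  by rewrite add0r -big_mkcond.
have := IHn b z (fun i j ij => y_le (lift ord0 i) (lift ord0 j) ij) b_le.
have := b_le 0%N; rewrite big_mkcond /= => b0_le.
have z0_ge : (0 <= z ord0 - y ord0)%R by rewrite subr_ge0 y_le.
have -> : z ord_max = y ord_max by congr (y _); exact/val_inj.
have -> : (\sum_(i < n.+2) a i * y i - (\sum_(i < n.+2) a i) * y ord0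
    = (\sum_(i < n.+1) b i * z i - (\sum_(i < n.+1) b i) * z ord0)
      + (\sum_(i < n.+1) b i) * (z ord0 - y ord0))%R.
  by rewrite !big_ord_recl -/b -/z; lra.
move=> IH; apply: (le_trans (ler_normD _ _)).
have -> : (M * (y ord_max - y ord0)
    = M * (y ord_max - z ord0) + M * (z ord0 - y ord0))%R by lra.
by rewrite lerD// normrM (ger0_norm z0_ge) ler_wpM2r.
Qed.

(** The factor 2 arises because [y ord0] enters twice: in the total increment [y ord_max - y ord0]
    and in the boundary term [T * y ord0]. *)
Lemma nondecreasing_sum_bound (R : realDomainType) (M : R) (n : nat)
    (a y : 'I_n.+1 -> R) :
  (forall i j : 'I_n.+1, (i <= j)%N -> (y i <= y j)%R) ->
  (forall k : nat, (`|\sum_(i < n.+1 | (k <= i)%N) a i| <= M)%R) ->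
  (`|\sum_(i < n.+1) a i * y i|
    <= M * (2 * `|y ord0| + `|y ord_max|))%R.
Proof.
move=> y_le a_le; have := abel_tail_bound R M n a y y_le a_le.
have := a_le 0%N; rewrite big_mkcond /=; set T := (\sum_(i < n.+1) a i)%R.
set S := (\sum_(i < n.+1) _)%R => T_le S_le.
have M0 : (0 <= M)%R by exact: le_trans T_le.
have -> : S = (S - T * y ord0 + T * y ord0)%R by rewrite subrK.
apply: (le_trans (ler_normD _ _)).
have -> : (M * (2 * `|y ord0| + `|y ord_max|)
   = M * (`|y ord0| + `|y ord_max|) + M * `|y ord0|)%R by lra.
rewrite lerD//; last by rewrite normrM ler_wpM2r.
apply: (le_trans S_le); rewrite ler_wpM2l//.
by rewrite addrC lerD ?ler_norm// -normrN ler_norm.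
Qed.

Section UpIndicator.
Context (d : Order.disp_t) (L : orderType d) (R : realType) (w : L).

Definition up_indicator (x : L) : R := (w <= x)%O%:R.

Fact up_indicator_homo : {homo up_indicator : x y / (x <= y)%O}.
Proof.
move=> x y xy; rewrite /up_indicator ler_nat.
by case: (leP w x) => // wx; rewrite (le_trans wx xy).
Qed.

HB.instance Definition _ :=
  Order.isOrderMorphism.Build d L _ R up_indicator up_indicator_homo.

(** In a linear order the meet of two elements is one of them, so monotonicity suffices. *)
Fact up_indicator_meet :
  {morph up_indicator : x y / (x `&` y)%O >-> (x `&` y)%O}.
Proof.
move=> x y; case/orP: (le_total x y) => xy.
- by rewrite (meet_idPl xy) (meet_idPl (up_indicator_homo _ _ xy)).
- by rewrite (meet_idPr xy) (meet_idPr (up_indicator_homo _ _ xy)).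
Qed.

Fact up_indicator_join :
  {morph up_indicator : x y / (x `|` y)%O >-> (x `|` y)%O}.
Proof.
move=> x y; case/orP: (le_total x y) => xy.
- by rewrite (join_idPr xy) (join_idPr (up_indicator_homo _ _ xy)).
- by rewrite (join_idPl xy) (join_idPl (up_indicator_homo _ _ xy)).
Qed.

HB.instance Definition _ := Order.isLatticeMorphism.Build d L _ R
  up_indicator up_indicator_meet up_indicator_join.

Fact up_indicator_itv (x : L) : up_indicator x \in `[-1, 1]%R.
Proof.
rewrite in_itv /= /up_indicator lern1 leq_b1 andbT.
exact: le_trans (lerN10 R) (ler0n R _).
Qed.

Definition up_dual : lattice_dual L R :=
  LatticeDual (dual_hom := up_indicator) up_indicator_itv.

Lemma up_dual_admissible : admissible (fun _ : 'I_1 => up_dual).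
Proof.
apply: ge_ereal_sup => _ [x _ <-]; rewrite big_ord1 lee_fin /= /up_indicator.
by rewrite normr_nat lern1 leq_b1.
Qed.

End UpIndicator.

(** With indices from 0, the vector paired with [a i] has its first [i.+1] coordinates equal to 1,
    so coordinate [k] survives iff [k <= i]. *)
Lemma c0_sum_summingE (R : realType) (m : nat) (a : 'I_m -> R) (k : nat) :
  (\sum_(i < m) a i *: summing R i.+1)%R k
  = (\sum_(i < m | (k <= i)%N) a i)%R.
Proof.
have -> : c0_val (\sum_(i < m) a i *: summing R i.+1)%R
    = (\sum_(i < m) a i *: summing_seq R i.+1)%R.
  exact: (raddf_sum (val : c0_space R -> _)).
rewrite fct_sumE [RHS]big_mkcond; apply: eq_bigr => i _.
rewrite -[LHS]/(a i * (k < i.+1)%N%:R)%R ltnS.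
by case: leqP => _; rewrite ?mulr1 ?mulr0.
Qed.

Lemma sum_deltaE (R : realType) (d : Order.disp_t) (L : latticeType d)
    (m : nat) (u : 'I_m -> L) (a : 'I_m -> R) (xs : lattice_dual L R) :
  (\sum_(i < m) a i *: delta (R := R) (u i))%R xs
  = (\sum_(i < m) a i * xs (u i))%R.
Proof. by rewrite fct_sumE. Qed.

Lemma fbl_norm_ge0 (d : Order.disp_t) (L : latticeType d) (R : realType)
    (f : lattice_dual L R -> R) : 0 <= fbl_norm f.
Proof.
apply: ereal_sup_ubound.
(* The empty family is admissible, even for empty [L], and contributes 0. *)
exists 0%N, (fun i : 'I_0 => False_rect _ (notF (ltn_ord i))).
split; last by rewrite big_ord0.
by apply: ge_ereal_sup => _ [x _ <-]; rewrite big_ord0 lee_fin.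
Qed.

Lemma fbl_norm_sum_delta_le (R : realType) (d : Order.disp_t)
    (L : latticeType d) (m : nat) (u : 'I_m -> L)
    (u_le : forall i j : 'I_m, (i <= j)%N -> (u i <= u j)%O)
    (a : 'I_m -> R) (M : R) :
  (forall k : nat, (`|\sum_(i < m | (k <= i)%N) a i| <= M)%R) ->
  fbl_norm (\sum_(i < m) a i *: delta (R := R) (u i))%R <= (3 * M)%:E.
Proof.
move=> a_le; have M0 : (0 <= M)%R by exact: le_trans (a_le 0%N).
apply: ge_ereal_sup => _ [n [xs [xs_adm ->]]].
rewrite lee_fin; under eq_bigr do rewrite sum_deltaE.
case: m u u_le a a_le => [|m] u u_le a a_le.
  by rewrite big1 ?mulr_ge0// => j _; rewrite big_ord0 normr0.
have adm x : (\sum_(j < n) `|xs j x| <= 1)%R.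
  rewrite -lee_fin; apply: le_trans xs_adm.
  by apply: ereal_sup_ubound; exists x.
apply: (@le_trans _ _ (\sum_(j < n)
    M * (2 * `|xs j (u ord0)| + `|xs j (u ord_max)|))%R).
  apply: ler_sum => j _.
  apply: (nondecreasing_sum_bound R M m a (fun i => xs j (u i))) => // i k ik.
  exact/Order.OrderMorphismTheory.omorph_le/u_le.
(* Admissibility at the two end points [u ord0] and [u ord_max] gives 2 + 1 = 3. *)
rewrite -mulr_sumr big_split /= -mulr_sumr mulrC ler_wpM2r//.
by have := adm (u ord0); have := adm (u ord_max); lra.
Qed.

Theorem proposition6p1 (R : realType) (d : Order.disp_t) (L : orderType d)
    (m : nat) (u : 'I_m -> L)
    (u_incr : forall i j : 'I_m, (i < j)%N -> (u i < u j)%O)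
    (a : 'I_m -> R) :
  c0_norm (\sum_(i < m) a i *: summing R i.+1)%R
    <= fbl_norm (\sum_(i < m) a i *: delta (R := R) (u i))%R
    <= 6%:E * c0_norm (\sum_(i < m) a i *: summing R i.+1)%R.
Proof.
have u_le (i j : 'I_m) : (i <= j)%N -> (u i <= u j)%O.
  by rewrite leq_eqVlt => /predU1P[/val_inj ->//|/u_incr/ltW].
have u_leE (i j : 'I_m) : (u i <= u j)%O = (i <= j)%N.
  apply/idP/idP => [|/u_le//].
  by apply: contraTT; rewrite -ltnNge -ltNge => /u_incr.
apply/andP; split.
  apply: ge_ereal_sup => _ [k _ <-]; rewrite c0_sum_summingE.
  (* Coordinates from [m] on are empty sums, hence 0; the others are attained by a one-element
     family. *)
  have [km|mk] := ltnP k m; last first.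
    rewrite big_pred0 ?normr0 ?fbl_norm_ge0// => i.
    by apply/negbTE; rewrite -ltnNge (leq_trans _ mk).
  apply: ereal_sup_ubound; exists 1%N, (fun=> up_dual d L R (u (Ordinal km))).
  split; first exact: up_dual_admissible.
  rewrite big_ord1 sum_deltaE big_mkcond /=; congr (`|_|%:E)%R.
  apply: eq_bigr => i _; rewrite /= /up_indicator u_leE /=.
  by case: leqP; rewrite ?mulr1 ?mulr0.
set c := (\sum_(i < m) a i *: summing R i.+1)%R.
have c_le k : `|c k|%:E <= c0_norm c by apply: ereal_sup_ubound; exists k.
have c_ge0 : 0 <= c0_norm c by apply: le_trans (c_le 0%N); rewrite lee_fin.
(* The norm is extended real: [-oo] contradicts [c_ge0], and at [+oo] the right-hand side is
   [+oo]. *)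
case E : (c0_norm c) c_ge0 c_le => [M| |]// c_ge0 c_le; last first.
  by rewrite gt0_muley ?lte_fin// leey.
apply: (@le_trans _ _ (3 * M)%:E).
  apply: fbl_norm_sum_delta_le => // k.
  by have := c_le k; rewrite c0_sum_summingE lee_fin.
by rewrite -EFinM lee_fin; move: c_ge0; rewrite lee_fin; lra.
Qed.
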